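(* The bimodal logic $\mathsf{L} = \mathsf{S4.1} \ast \mathsf{S4.1} + \Diamond_1\Box_2(\Diamond_1 p \to \Box_1 p) + \Diamond_2\Box_1(\Diamond_2 p \to \Box_2 p)$ has the finite model property and is decidable.
   Context: **Formulas and logics.** Fix a countable set $\mathrm{PROP}$ of propositional variables. $N$-modal formulas are generated by $A ::= p \mid \bot \mid (A\to A)\mid \Box_i A$ ($p\in\mathrm{PROP}$, $1\le i\le N$); other connectives are derived and $\Diamond_i A := \neg\Box_i\neg A$. For $N=1$ the index is omitted. An ($N$-)modal logic is a set of $N$-modal formulas containing all classical propositional tautologies and the axioms $\Box_i(p\to q)\to(\Box_i p\to\Box_i q)$, and closed under uniform substitution, modus ponens and necessitation ($A/\Box_i A$ for each $i$). $\mathsf{K}_N$ is the smallest $N$-modal logic, $\mathsf{K}=\mathsf{K}_1$. For a logic $\mathsf{M}$ and a set of formulas $\Gamma$, $\mathsf{M}+\Gamma$ is the smallest modal logic containing $\mathsf{M}\cup\Gamma$ (for a single formula $A$ write $\mathsf{M}+A$). $\mathsf{S4}=\mathsf{K}+\{\Box p\to p,\ \Box p\to\Box\Box p\}$ and $\mathsf{S4.1}=\mathsf{S4}+(\Box\Diamond p\to\Diamond\Box p)$. The fusion of unimodal logics is $\mathsf{L}_1\ast\mathsf{L}_2=\mathsf{K}_2+\mathsf{L}_1'+\mathsf{L}_2'$, where $\mathsf{L}_i'$ is obtained from $\mathsf{L}_i$ by replacing $\Box$ with $\Box_i$. **Kripke semantics.** A Kripke $2$-frame is $F=(W,R_1,R_2)$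 with $W\neq\varnothing$ and $R_i\subseteq W\times W$. Given a valuation $V:\mathrm{PROP}\to2^W$, truth is defined as usual, with $x\models\Box_iA$ iff $y\models A$ for all $y$ with $xR_iy$. $F\models A$ means $A$ is true at every point under every valuation. For a class $\mathcal{C}$ of frames, $\mathrm{Log}(\mathcal{C})$ is the set of formulas valid in all frames of $\mathcal{C}$. A logic has the finite model property if it equals $\mathrm{Log}(\mathcal{C})$ for some class $\mathcal{C}$ of finite Kripke frames. A logic is decidable if there is an algorithm deciding, for a given formula, whether it belongs to the logic. *)

(* Defs.v *)
From mathcomp Require Import all_boot.
From mathcomp Require Import classical_sets functions cardinality.

Set Implicit Arguments.
Unset Strict Implicit.
Unset Printing Implicit Defensive.

Local Open Scope classical_set_scope.

(* Propositional variables are natural numbers; the modalities 1..N are the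
   elements of 'I_N. *)

Inductive form (N : nat) : Type :=
| Var of nat
| Bot
| Imp of form N & form N
| Box of 'I_N & form N.

Arguments Var {N} _.
Arguments Bot {N}.

Definition Neg N (A : form N) : form N := Imp A Bot.
Definition Dia N (i : 'I_N) (A : form N) : form N := Neg (Box i (Neg A)).

Fixpoint subst N (s : nat -> form N) (A : form N) : form N :=
  match A with
  | Var p => s p
  | Bot => Bot
  | Imp B C => Imp (subst s B) (subst s C)
  | Box i B => Box i (subst s B)
  end.

(* Truth-table evaluation in which variables and boxed formulas are atoms. *)
Fixpoint beval N (v : form N -> bool) (A : form N) : bool :=
  match A with
  | Bot => false
  | Imp B C => beval v B ==> beval v C
  | Var _ | Box _ _ => v A
  end.

Definition tautology N (A : form N) : Prop := forall v, beval v A.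

Record modal_logic N (L : set (form N)) : Prop := ModalLogic {
  logic_taut : forall A, tautology A -> L A;
  logic_K : forall i : 'I_N,
    L (Imp (Box i (Imp (Var 0) (Var 1))) (Imp (Box i (Var 0)) (Box i (Var 1))));
  logic_subst : forall s A, L A -> L (subst s A);
  logic_mp : forall A B, L A -> L (Imp A B) -> L B;
  logic_nec : forall i A, L A -> L (Box i A)
}.

Definition K (N : nat) : set (form N) := smallest (@modal_logic N) set0.
Arguments K N : clear implicits.

(* Written M + G in the literature. *)
Definition ext N (M G : set (form N)) : set (form N) :=
  smallest (@modal_logic N) (M `|` G).

Definition S4 : set (form 1) :=
  let p := Var 0 in
  ext (K 1) [set Imp (Box ord0 p) p; Imp (Box ord0 p) (Box ord0 (Box ord0 p))].

Definition S4_1 : set (form 1) :=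
  let p := Var 0 in
  ext S4 [set Imp (Box ord0 (Dia ord0 p)) (Dia ord0 (Box ord0 p))].

Fixpoint rename_box N (i : 'I_N) (A : form 1) : form N :=
  match A with
  | Var p => Var p
  | Bot => Bot
  | Imp B C => Imp (rename_box i B) (rename_box i C)
  | Box _ B => Box i (rename_box i B)
  end.

Definition box1 : 'I_2 := ord0.
Definition box2 : 'I_2 := ord_max.

Definition fusion (L1 L2 : set (form 1)) : set (form 2) :=
  ext (ext (K 2) (rename_box box1 @` L1)) (rename_box box2 @` L2).

Definition mix_axiom (i j : 'I_2) : form 2 :=
  Dia i (Box j (Imp (Dia i (Var 0)) (Box i (Var 0)))).

Record frame (N : nat) : Type := Frame {
  world : Type;
  world_inhabited : inhabited world;
  acc : 'I_N -> world -> world -> Prop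
}.

Fixpoint sat N (F : frame N) (V : nat -> set (world F)) (x : world F)
    (A : form N) : Prop :=
  match A with
  | Var p => V p x
  | Bot => False
  | Imp B C => sat V x B -> sat V x C
  | Box i B => forall y, acc i x y -> sat V y B
  end.

Definition valid N (F : frame N) (A : form N) : Prop :=
  forall (V : nat -> set (world F)) (x : world F), sat V x A.

Definition Log N (C : set (frame N)) : set (form N) :=
  [set A | forall F, C F -> valid F A].

Definition finite_model_property N (L : set (form N)) : Prop :=
  exists C : set (frame N),
    (forall F, C F -> finite_set [set: world F]) /\ L = Log C.

(* Algorithms are Kleene's partial recursive functions, applied to Goedel
   numbers of formulas.  (Informative excluded middle would make a
   [{L A} + {~ L A}] formulation vacuous.) *)

Inductive recfun : nat -> Type :=
| RZero n : recfun n
| RSucc : recfun 1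
| RProj n of 'I_n : recfun n
| RComp m n of recfun m & ('I_m -> recfun n) : recfun n
| RPrec n of recfun n & recfun n.+2 : recfun n.+1
| RMin n of recfun n.+1 : recfun n.

(* [computes f x y]: the partial function f is defined at x with value y.
   In primitive recursion, u k is the k-th intermediate value, and the step
   function takes (k, u k, parameters). *)
Fixpoint computes n (f : recfun n) : n.-tuple nat -> nat -> Prop :=
  match f in recfun n return n.-tuple nat -> nat -> Prop with
  | RZero _ => fun _ y => y = 0
  | RSucc => fun x y => y = (thead x).+1
  | RProj _ i => fun x y => y = tnth x i
  | RComp m _ g h => fun x y =>
      exists z : m.-tuple nat,
        (forall i, computes (h i) x (tnth z i)) /\ computes g z y
  | RPrec _ g h => fun x y =>
      exists u : nat -> nat,
        [/\ computes g [tuple of behead x] (u 0),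
            forall k, k < thead x ->
              computes h [tuple of k :: u k :: behead x] (u k.+1)
          & y = u (thead x)]
  | RMin _ g => fun x y =>
      computes g [tuple of y :: x] 0 /\
      forall z, z < y -> exists v, computes g [tuple of z :: x] v.+1
  end.

(* Cantor's pairing bijection. *)
Definition cpair (a b : nat) : nat := ((a + b) * (a + b).+1)./2 + b.

Fixpoint goedel N (A : form N) : nat :=
  match A with
  | Var p => cpair 0 p
  | Bot => cpair 1 0
  | Imp B C => cpair 2 (cpair (goedel B) (goedel C))
  | Box i B => cpair 3 (cpair i (goedel B))
  end.

Definition decidable_logic N (L : set (form N)) : Prop :=
  exists f : recfun 1, forall A : form N,
    (L A -> computes f [tuple goedel A] 1) /\
    (~ L A -> computes f [tuple goedel A] 0).

(* Main.v *)
Require Import Defs.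
From HB Require Import structures.
From mathcomp Require Import all_boot.
From mathcomp Require Import boolp classical_sets cardinality.

Set Implicit Arguments.
Unset Strict Implicit.
Unset Printing Implicit Defensive.

Local Open Scope classical_set_scope.

(** Write R_1, R_2 for the two relations of a frame and call a point i-terminal
    when it sees nothing but itself along R_i.  If R_1 and R_2 are
    preorders, then all axioms are valid as soon as, for both i and with j the
    other index, every point sees along R_i some y all of whose R_j-successors
    are i-terminal; y is one of these successors, so the McKinsey axiom holds
    for R_i too ([mixed_S4_1_sound]).  The theorem follows once every formula A
    outside the logic is refuted on such a frame, of a size bounded in terms
    of A.

    That frame is a filtration of the canonical model.  Let D_i say that every
    subformula B of A is decided, that is, that <>_i B implies []_i B.  The
    McKinsey axiom makes every maximal consistent set see one with D_i
    ([sees_all_decided]); substituting ~ D_i in the mixed axiom, which is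
    stated for one variable only, then makes every one see a point with
    E_i = []_j D_i ([sees_terminal_mark]).  Points of the filtration carry the
    truth values of the subformulas of A and of E_1, E_2.  Points with E_i are
    declared i-terminal: since the subformulas of A are decided there, nothing
    is lost for the truth lemma.  The other points see along R_i whatever
    inherits their []_i-formulas, E_j included.  Being itself a []_j-formula,
    E_i is inherited along R_j, so every R_j-successor of a point with E_i is
    i-terminal ([filter_frame_mix]).  Dropping the requirement that canonical
    successors stay successors is what allows terminal points for both
    relations at once: a filtration that keeps it has to decide E_2 at the
    points with E_1 and conversely, which is circular.

    Decidability follows by brute force: A is outside the logic exactly when there is a
    countermodel on at most 2 ^ (goedel A + 3) points.  Relations, truth tables
    and sets of formula codes are given by the binary digits of numbers below
    explicit bounds, and the truth of all subformulas is expressed by local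
    conditions on the table, so the search only takes arithmetic and bounded
    quantifiers ([refuted], [recursive_refuted]) and needs no recursion on
    formulas. *)

(** * Goedel numbers *)

Lemma triangle_succ s : (s.+1 * s.+2)./2 = (s * s.+1)./2 + s.+1.
Proof.
have -> : s.+1 * s.+2 = s * s.+1 + s.+1.*2 by rewrite -mul2n -mulnDl addn2 mulnC.
by rewrite halfD odd_double andbF add0n doubleK.
Qed.

Lemma leq_triangle s s' : s <= s' -> (s * s.+1)./2 <= (s' * s'.+1)./2.
Proof. by move=> le_ss'; apply/half_leq/leq_mul. Qed.

Lemma leq_triangle_self s : s <= (s * s.+1)./2.
Proof. by case: s => // s; rewrite triangle_succ leq_addl. Qed.

(** The pairs of sum [s] exactly fill the interval from one triangular number to
    the next. *)
Lemma cpair_diagonal a b a' b' : a + b < a' + b' -> cpair a b < cpair a' b'.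
Proof.
move=> lt_ss'; rewrite /cpair.
apply: leq_trans (leq_trans (leq_triangle lt_ss') (leq_addr _ _)).
by rewrite triangle_succ addnS ltnS leq_add2l leq_addl.
Qed.

Lemma cpair_inj a b a' b' : cpair a b = cpair a' b' -> a = a' /\ b = b'.
Proof.
move=> eq_ab; have [lt_s|lt_s|eq_s] := ltngtP (a + b) (a' + b').
- by have := cpair_diagonal lt_s; rewrite eq_ab ltnn.
- by have := cpair_diagonal lt_s; rewrite eq_ab ltnn.
have eq_b : b = b' by move: eq_ab; rewrite /cpair eq_s => /addnI.
by split=> //; move: eq_s; rewrite eq_b => /addIn.
Qed.

Lemma cpair_lt a b a' b' : a < a' -> b < b' -> cpair a b < cpair a' b'.
Proof.
by move=> lt_a lt_b; apply: cpair_diagonal; rewrite -addSn leq_add // ltnW.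
Qed.

Lemma leq_cpair a b : a + b <= cpair a b.
Proof. exact: leq_trans (leq_triangle_self _) (leq_addr _ _). Qed.

Lemma leq_cpair2 m : m + 3 <= cpair 2 m.
Proof.
by rewrite addnC /cpair leq_add2r -[3]/((2 * 3)./2); apply: leq_triangle.
Qed.

Lemma goedel_inj N : injective (@goedel N).
Proof.
elim=> [p||B IHB C IHC|i B IHB] [q||B' C'|j B'] //= /cpair_inj[] //.
- by move=> _ ->.
- by move=> _ /cpair_inj[/IHB -> /IHC ->].
- by move=> _ /cpair_inj[/val_inj -> /IHB ->].
Qed.

HB.instance Definition _ N := Equality.copy (form N) (inj_type (@goedel_inj N)).

Fixpoint subformulas N (A : form N) : seq (form N) :=
  A :: match A with
       | Var _ | Bot => [::]
       | Imp B C => subformulas B ++ subformulas C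
       | Box _ B => subformulas B
       end.

Lemma mem_subformulas N (A : form N) : A \in subformulas A.
Proof. by case: A => *; rewrite inE eqxx. Qed.

Lemma subformulas_imp N (A B C : form N) :
  Imp B C \in subformulas A -> B \in subformulas A /\ C \in subformulas A.
Proof.
elim: A => [p||A1 IH1 A2 IH2|i A IHA]; rewrite [subformulas _]/= ?inE.
- by move=> /eqP.
- by move=> /eqP.
- case/orP=> [/eqP[-> ->]|].
    by rewrite !mem_cat !mem_subformulas !orbT.
  by rewrite !mem_cat => /orP[/IH1|/IH2][-> ->]; rewrite !orbT.
- by case/orP=> [/eqP|/IHA[-> ->]] //; rewrite !orbT.
Qed.

Lemma subformulas_box N (A B : form N) i :
  Box i B \in subformulas A -> B \in subformulas A.
Proof.
elim: A => [p||A1 IH1 A2 IH2|j A IHA]; rewrite [subformulas _]/= ?inE.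
- by move=> /eqP.
- by move=> /eqP.
- case/orP=> [/eqP|] //.
  by rewrite !mem_cat => /orP[/IH1|/IH2] ->; rewrite !orbT.
- by case/orP=> [/eqP[_ ->]|/IHA->]; rewrite ?mem_subformulas orbT.
Qed.

Lemma size_subformulas N (A : form N) : size (subformulas A) <= (goedel A).+1.
Proof.
elim: A => [p||B IHB C IHC|i B IHB] //=; rewrite ltnS.
  rewrite size_cat; apply: leq_trans (leq_add IHB IHC) _.
  apply: leq_trans (leq_cpair2 _); rewrite addSn addnS -[_.+2]addn2.
  by rewrite leq_add // leq_cpair.
apply: leq_trans IHB _; apply: leq_trans _ (leq_cpair 3 _).
rewrite add3n ltnS (leq_trans (leq_addl i _)) // (leq_trans (leq_cpair _ _)) //.
by rewrite -addn2 leq_addr.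
Qed.

Lemma goedel_subformulas N (A B : form N) :
  B \in subformulas A -> goedel B <= goedel A.
Proof.
have le_cpair2 k a b : a + b <= cpair k (cpair a b).
  by apply: leq_trans (leq_cpair _ _) _; rewrite (leq_trans _ (leq_cpair _ _)) ?leq_addl.
elim: A => [p||A1 IH1 A2 IH2|i A IHA]; rewrite [subformulas _]/= ?inE.
- by move=> /eqP->.
- by move=> /eqP->.
- case/orP=> [/eqP-> //|]; rewrite mem_cat.
  case/orP=> [/IH1|/IH2] le_B; apply: leq_trans le_B (leq_trans _ (le_cpair2 _ _ _)).
    exact: leq_addr.
  exact: leq_addl.
- case/orP=> [/eqP-> //|/IHA le_B].
  exact: leq_trans le_B (leq_trans (leq_addl _ _) (le_cpair2 _ _ _)).
Qed.

(** * Maximal consistent sets *)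

Definition imps N (s : seq (form N)) (C : form N) : form N := foldr (@Imp N) C s.

Lemma beval_imps N v (s : seq (form N)) C :
  beval v (imps s C) = all (beval v) s ==> beval v C.
Proof. by elim: s => //= B s ->; case: (beval v B). Qed.

Section CanonicalModel.

Variables (N : nat) (L : set (form N)).
Hypothesis logicL : modal_logic L.

Definition derives (Y : set (form N)) (C : form N) : Prop :=
  exists2 s : seq (form N), (forall B, B \in s -> Y B) & L (imps s C).

Lemma derives_consequence2 Y A B C : derives Y A -> derives Y B ->
  (forall v, beval v A -> beval v B -> beval v C) -> derives Y C.
Proof.
move=> [s Ys LsA] [t Yt LtB] ABC; exists (s ++ t).
  by move=> D; rewrite mem_cat => /orP[/Ys|/Yt].
apply: logic_mp LtB _ => //; apply: logic_mp LsA _ => //; apply: logic_taut => //.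
move=> v /=; rewrite !beval_imps all_cat; move: (ABC v).
by case: (all _ s); case: (all _ t); case: (beval v A); case: (beval v B);
  case: (beval v C) => //= /(_ isT isT).
Qed.

Lemma derives_mem (Y : set (form N)) C : Y C -> derives Y C.
Proof.
move=> YC; exists [:: C]; first by move=> D; rewrite inE => /eqP->.
by apply: logic_taut => // v; rewrite /= implybb.
Qed.

Lemma derives_logic Y C : L C -> derives Y C.
Proof. by move=> LC; exists [::]. Qed.

Lemma deduction Y B C : derives (Y `|` [set B]) C -> derives Y (Imp B C).
Proof.
move=> [s Ys LsC]; exists (rem B (undup s)).
  by move=> D; rewrite mem_rem_uniq ?undup_uniq // !inE mem_undup => /andP[/eqP DB /Ys[]].
apply: logic_mp LsC _ => //; apply: logic_taut => // v.
rewrite /= !beval_imps /=; apply/implyP => sC; apply/implyP => /allP s'v.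
apply/implyP => Bv; apply: (implyP sC); apply/allP => D Ds.
have [->//|DB] := eqVneq D B.
by apply: s'v; rewrite mem_rem_uniq ?undup_uniq // !inE DB mem_undup.
Qed.

Record mcs (x : set (form N)) : Prop := Mcs {
  mcs_logic : L `<=` x;
  mcs_mp : forall A B, x (Imp A B) -> x A -> x B;
  mcs_bot : ~ x Bot;
  mcs_total : forall A, x A \/ x (Neg A)
}.

(** By Zorn's lemma there is a maximal [A] such that [Y `|` A] does not derive
    [C].  A formula outside this set implies [C] in its presence; hence it is
    deductively closed, and it cannot miss both a formula and its negation. *)
Lemma lindenbaum Y C : ~ derives Y C -> exists x, [/\ mcs x, Y `<=` x & ~ x C].
Proof.
move=> YC; pose P Z := ~ derives (Y `|` Z) C.
have [F FP Ftot|A [PA maxA]] := @Zorn_bigcup _ P.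
  have [[Z0 FZ0]|F0] := pselect (exists Z, F Z); last first.
    move=> [s Ys LsC]; apply: YC; exists s => // B /Ys[//|[Z FZ _]].
    by case: F0; exists Z.
  move=> [s Ys LsC].
  (* a finite part of the union of a chain lies in one of its members *)
  have [Z FZ sZ] : exists2 Z, F Z & forall B, B \in s -> (Y `|` Z) B.
    elim: s Ys {LsC} => [|B s IHs] Ys; first by exists Z0.
    have [|Z FZ sZ] := IHs; first by move=> D Ds; apply: Ys; rewrite inE Ds orbT.
    have [YB|[Z' FZ' Z'B]] := Ys B (mem_head _ _).
      by exists Z => // D; rewrite inE => /orP[/eqP->|/sZ //]; left.
    have [ZZ'|Z'Z] := Ftot _ _ FZ FZ'.
      exists Z' => // D; rewrite inE => /orP[/eqP->|/sZ]; first by right.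
      by case=> [|/ZZ']; [left|right].
    exists Z => // D; rewrite inE => /orP[/eqP->|/sZ //].
    by right; exact: Z'Z.
  by apply: (FP _ FZ); exists s.
pose x := Y `|` A.
have impC B : ~ x B -> derives x (Imp B C).
  move=> xB; apply: deduction; rewrite /x -setUA; apply: contrapT => AB.
  apply: maxA AB; split; first by move=> D AD; left.
  by move=> /(_ B (or_intror erefl)) AB; apply: xB; right.
have closed B : derives x B -> x B.
  move=> derB; apply: contrapT => /impC derBC; apply: PA.
  by apply: derives_consequence2 derB derBC _ => v /= ->.
exists x; split; first split.
- by move=> B LB; apply/closed/derives_logic.
- move=> B D /derives_mem BD /derives_mem derB; apply: closed.
  by apply: derives_consequence2 BD derB _ => v /= /implyP.
- move=> /derives_mem derBot; apply: PA.
  by apply: (derives_consequence2 derBot derBot) => v.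
- move=> B; have [xB|/impC BC] := pselect (x B); first by left.
  right; apply: contrapT => /impC NBC; apply: PA.
  by apply: derives_consequence2 BC NBC _ => v /=; case: (beval v B).
- by move=> B YB; left.
- by move=> /derives_mem.
Qed.

Lemma mcs_imp x A B : mcs x -> x (Imp A B) <-> (x A -> x B).
Proof.
move=> mx; split; first exact: mcs_mp.
have derive D E : x D -> (forall v, beval v D -> beval v E) -> x E.
  move=> xD DE; apply: mcs_mp xD => //; apply: mcs_logic => //.
  by apply: logic_taut => // v; apply/implyP/DE.
have [xB _|xNB AB] := mcs_total mx B; first by apply: derive xB _ => v /= ->; rewrite implybT.
have [/AB xB|xNA] := mcs_total mx A; first by have /(mcs_bot mx) := mcs_mp mx xNB xB.
by apply: derive xNA _ => v /=; case: (beval v A).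
Qed.

Lemma mcs_neg x A : mcs x -> x (Neg A) <-> ~ x A.
Proof. by move=> mx; rewrite (mcs_imp _ _ mx); split=> xA /xA // /(mcs_bot mx). Qed.

Definition conj (s : seq (form N)) : form N := Neg (imps s Bot).

Lemma mcs_imps x s C : mcs x ->
  x (imps s C) <-> ((forall B, B \in s -> x B) -> x C).
Proof.
move=> mx; elim: s => [|B s IHs] /=; first by split=> [//|]; apply.
rewrite (mcs_imp _ _ mx) IHs; split=> [xsC xs|xsC xB xs].
  by apply: xsC => [|D Ds]; apply: xs; rewrite inE ?eqxx ?Ds ?orbT.
by apply: xsC => D; rewrite inE => /orP[/eqP->|/xs].
Qed.

Lemma mcs_conj x s : mcs x -> x (conj s) <-> forall B, B \in s -> x B.
Proof.
move=> mx; rewrite (mcs_neg _ mx) (mcs_imps _ _ mx); split=> [xs B Bs|xs sBot].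
  by apply: contrapT => xB; apply: xs => /(_ B Bs).
exact: (mcs_bot mx (sBot xs)).
Qed.

Definition canonical_acc i (x y : set (form N)) : Prop := forall B, x (Box i B) -> y B.

Lemma mcs_box_imp x i A B : mcs x -> x (Box i (Imp A B)) -> x (Box i A) -> x (Box i B).
Proof.
move=> mx xAB; apply: mcs_mp => //; apply: mcs_mp xAB => //; apply: mcs_logic => //.
exact: (logic_subst logicL (fun k => if k is 0 then A else B) (logic_K logicL i)).
Qed.

(** Necessitation and the axiom K turn a derivation of [B] from finitely many
    formulas into one of [Box i B] from their necessitations. *)
Lemma mcs_box x i B : mcs x ->
  x (Box i B) <-> forall y, mcs y -> canonical_acc i x y -> y B.
Proof.
move=> mx; split=> [xB y _|xB]; first exact.
apply: contrapT => xNB.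
have [[s xs LsB]|y [my xy yB]] := @lindenbaum [set C | x (Box i C)] B;
  last exact: yB (xB y my xy).
apply: xNB; have /(mcs_logic mx) : L (Box i (imps s B)) by exact: logic_nec.
elim: s xs {LsB} => //= C s IHs xs xCs; apply: IHs => [D Ds|].
  by apply: xs; rewrite inE Ds orbT.
by apply: mcs_box_imp xCs _ => //; apply: xs; rewrite mem_head.
Qed.

Lemma mcs_dia x i B : mcs x ->
  x (Dia i B) <-> exists y, [/\ mcs y, canonical_acc i x y & y B].
Proof.
move=> mx; rewrite (mcs_neg _ mx) (mcs_box _ _ mx); split=> [xB|[y [my xy yB]] xNB].
  apply: contrapT => noy; apply: xB => y my xy; apply/(mcs_neg _ my) => yB.
  by apply: noy; exists y.
by have /(mcs_neg _ my) := xNB y my xy.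
Qed.

Lemma not_logic_mcs A : ~ L A -> exists2 x, mcs x & ~ x A.
Proof.
move=> LA; have [[s s0 LsA]|x [mx _ xA]] := @lindenbaum set0 A; last by exists x.
by apply: LA; case: s s0 LsA => // B s /(_ B (mem_head _ _)).
Qed.

End CanonicalModel.
(** * Points deciding finitely many formulas *)

(** What the completeness proof uses of the logic. *)
Record mix_logic (L : set (form 2)) : Prop := MixLogic {
  mix_modal : modal_logic L;
  mix_T : forall i, L (Imp (Box i (Var 0)) (Var 0));
  mix_4 : forall i, L (Imp (Box i (Var 0)) (Box i (Box i (Var 0))));
  mix_McKinsey : forall i, L (Imp (Box i (Dia i (Var 0))) (Dia i (Box i (Var 0))));
  mix_mix : forall i, L (mix_axiom i (rev_ord i))
}.

Definition decided (i : 'I_2) (B : form 2) : form 2 := Imp (Dia i B) (Box i B).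

Definition all_decided (i : 'I_2) (s : seq (form 2)) : form 2 :=
  conj [seq decided i B | B <- s].

(** The points satisfying this formula become terminal for [i] in the
    filtration.  It is boxed by the other modality so as to be inherited along
    the other relation. *)
Definition terminal_mark (i : 'I_2) (s : seq (form 2)) : form 2 :=
  Box (rev_ord i) (all_decided i s).

Section MixCanonical.

Variable L : set (form 2).
Hypothesis mixL : mix_logic L.

Let logicL : modal_logic L := mix_modal mixL.

Lemma mcs_T x i B : mcs L x -> x (Box i B) -> x B.
Proof.
move=> mx; apply: (mcs_mp mx); apply: (mcs_logic mx).
exact: (logic_subst logicL (fun=> B) (mix_T mixL i)).
Qed.

Lemma mcs_4 x i B : mcs L x -> x (Box i B) -> x (Box i (Box i B)).
Proof.
move=> mx; apply: (mcs_mp mx); apply: (mcs_logic mx).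
exact: (logic_subst logicL (fun=> B) (mix_4 mixL i)).
Qed.

Lemma canonical_refl i x : mcs L x -> canonical_acc i x x.
Proof. by move=> mx B; apply: mcs_T. Qed.

Lemma canonical_trans i x y z : mcs L x ->
  canonical_acc i x y -> canonical_acc i y z -> canonical_acc i x z.
Proof. by move=> mx xy yz B /(mcs_4 mx)/xy/yz. Qed.

Lemma mcs_dia_self x i B : mcs L x -> x B -> x (Dia i B).
Proof.
move=> mx xB; apply/(mcs_dia logicL _ _ mx); exists x; split=> //.
exact: canonical_refl.
Qed.

(** A successor sees no more than the point itself does, so it inherits the
    failure of [Dia i B], and by transitivity the truth of [Box i B]. *)
Lemma decided_persistent i x y B : mcs L x -> mcs L y -> canonical_acc i x y ->
  x (decided i B) -> y (decided i B).
Proof.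
move=> mx my xy /(mcs_imp logicL _ _ mx) xB; apply/(mcs_imp logicL _ _ my) => yB.
apply: (xy); apply: (mcs_4 mx); apply: xB; apply/(mcs_dia logicL _ _ mx).
have [z [mz yz zB]] := (mcs_dia logicL i B my).1 yB.
by exists z; split=> //; exact: (canonical_trans mx xy yz).
Qed.

Lemma sees_decided i x B : mcs L x ->
  exists y, [/\ mcs L y, canonical_acc i x y & y (decided i B)].
Proof.
move=> mx; have [xBDB|xBDB] := pselect (x (Box i (Dia i B))).
  have /(mcs_dia logicL _ _ mx)[y [my xy yB]] : x (Dia i (Box i B)).
    apply: (mcs_mp mx) xBDB; apply: (mcs_logic mx).
    exact: (logic_subst logicL (fun=> B) (mix_McKinsey mixL i)).
  by exists y; split=> //; apply/(mcs_imp logicL _ _ my).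
have [y [my xy yB]] : exists y, [/\ mcs L y, canonical_acc i x y & ~ y (Dia i B)].
  apply: contrapT => noy; apply: xBDB; apply/(mcs_box logicL _ _ mx) => y my xy.
  by apply: contrapT => yB; apply: noy; exists y.
by exists y; split=> //; apply/(mcs_imp logicL _ _ my) => /yB.
Qed.

(** The McKinsey axiom settles one formula at a time; what has been settled
    stays settled further up, so the choices can be made in a row. *)
Lemma sees_all_decided i x s : mcs L x ->
  exists y, [/\ mcs L y, canonical_acc i x y & y (all_decided i s)].
Proof.
move=> mx; suff [y [my xy ys]] : exists y, [/\ mcs L y, canonical_acc i x y &
    forall B, B \in s -> y (decided i B)].
  exists y; split=> //; apply/(mcs_conj logicL _ my) => _ /mapP[B Bs ->].
  exact: ys.
elim: s => [|B s [y [my xy ys]]].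
  by exists x; split=> //; exact: canonical_refl.
have [z [mz yz zB]] := sees_decided i B my.
exists z; split=> // [|C]; first exact: (canonical_trans mx xy yz).
by rewrite inE => /orP[/eqP-> //|/ys]; exact: (decided_persistent my mz yz).
Qed.

(** The mix axiom speaks of a single formula [q].  Taking for [q] the negation
    of [all_decided i s] is enough: where that negation is decided it must be
    false, as a point satisfying [all_decided i s] is always seen. *)
Lemma sees_terminal_mark i x s : mcs L x ->
  exists y, [/\ mcs L y, canonical_acc i x y & y (terminal_mark i s)].
Proof.
move=> mx; pose q := Neg (all_decided i s).
have /(mcs_dia logicL _ _ mx)[y [my xy yq]] : x (Dia i (Box (rev_ord i) (decided i q))).
  by apply: (mcs_logic mx); exact: (logic_subst logicL (fun=> q) (mix_mix mixL i)).
exists y; split=> //; apply/(mcs_box logicL _ _ my) => z mz yz.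
have /(mcs_imp logicL _ _ mz) zq := (mcs_box logicL _ _ my).1 yq z mz yz.
apply: contrapT => zD; have zq' : z q by apply/(mcs_neg logicL (all_decided i s) mz).
have /zq zBq := mcs_dia_self i mz zq'.
have [w [mw zw ws]] := sees_all_decided i s mz.
by have /(mcs_neg logicL (all_decided i s) mw) := zw _ zBq.
Qed.

(** This replaces, at a point seeing only itself, the successors that refute
    boxed formulas. *)
Lemma all_decided_box i x s B : mcs L x -> x (all_decided i s) -> B \in s ->
  x B -> x (Box i B).
Proof.
move=> mx /(mcs_conj logicL _ mx) xs Bs xB.
have /xs/(mcs_imp logicL _ _ mx) : decided i B \in [seq decided i B | B <- s] by exact: map_f.
by apply; exact: mcs_dia_self.
Qed.

End MixCanonical.

(** * Completeness with respect to finite frames *)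

Definition terminal (F : frame 2) i (x : world F) : Prop := forall y, acc i x y -> y = x.

Record mix_frame (F : frame 2) : Prop := MixFrame {
  frame_refl : forall i (x : world F), acc i x x;
  frame_trans : forall i (x y z : world F), acc i x y -> acc i y z -> acc i x z;
  frame_mix : forall i (x : world F), exists2 y, acc i x y &
    forall z, acc (rev_ord i) y z -> terminal i z
}.

(** The worlds of the finite frames below.  The type of ordinals lives in too
    high a universe to serve as the carrier of a frame. *)
Definition segment (n : nat) : Set := {k : nat | k < n}.

Definition segment_of_ord n (i : 'I_n) : segment n := exist _ (val i) (ltn_ord i).

Lemma segment_of_ord_inj n : injective (@segment_of_ord n).
Proof. by move=> i j [eq_ij]; exact: val_inj. Qed.

Lemma segment_eq n (x y : segment n) : sval x = sval y -> x = y.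
Proof. exact: val_inj. Qed.

Lemma finite_segment n : finite_set [set: segment n].
Proof.
have -> : [set: segment n] = @segment_of_ord n @` [set: 'I_n].
  by apply/seteqP; split=> // x _; exists (Ordinal (svalP x)) => //; exact: segment_eq.
exact/finite_image/finite_finset.
Qed.

Section Filtration.

Variable L : set (form 2).
Hypothesis mixL : mix_logic L.

Let logicL : modal_logic L := mix_modal mixL.

Variable A : form 2.

Definition filter_formulas : seq (form 2) :=
  [:: terminal_mark box1 (subformulas A), terminal_mark box2 (subformulas A)
    & subformulas A].

Let G := filter_formulas.

Lemma ord2P (i : 'I_2) : i = box1 \/ i = box2.
Proof. by case: i => [[|[|m]] lt_m] //; [left|right]; apply: val_inj. Qed.

Lemma mem_terminal_mark i : terminal_mark i (subformulas A) \in G.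
Proof. by case: (ord2P i) => ->; rewrite !inE eqxx ?orbT. Qed.

Lemma sub_filter_formulas B : B \in subformulas A -> B \in G.
Proof. by move=> BA; rewrite !inE BA !orbT. Qed.

Definition filter_size : nat := #|{: (size G).-tuple bool}|.

Definition filter_type (x : set (form 2)) : segment filter_size :=
  segment_of_ord (enum_rank [tuple `[< x (tnth (in_tuple G) k) >] | k < size G]).

Lemma filter_type_eq x y B : filter_type x = filter_type y -> B \in G -> x B -> y B.
Proof.
move=> /segment_of_ord_inj/enum_rank_inj eq_xy /(tnthP (in_tuple G))[k ->] xB; apply/asboolP.
by have := congr1 (fun t => tnth t k) eq_xy; rewrite !tnth_mktuple => <-; apply/asboolP.
Qed.

(** Every type has a representative, those realized by no maximal consistent
    set included: a superfluous copy of a point does no harm, and this fixes the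
    number of worlds of the filtration. *)
Lemma filter_representatives : ~ L A -> exists rep : segment filter_size -> set (form 2),
  (forall t, mcs L (rep t)) /\
  (forall y, mcs L y -> exists t, forall B, B \in G -> rep t B <-> y B).
Proof.
move=> /(not_logic_mcs logicL)[x0 mx0 _].
have /choice[rep repP] : forall t, exists x,
    mcs L x /\ forall y, mcs L y -> filter_type y = t -> filter_type x = t.
  move=> t; have [[y [my yt]]|noy] := pselect (exists y, mcs L y /\ filter_type y = t).
    by exists y; split.
  by exists x0; split=> // y my yt; case: noy; exists y.
exists rep; split=> [t|y my]; first by case: (repP t).
exists (filter_type y) => B BG.
have [_ /(_ y my erefl) eq_y] := repP (filter_type y).
by split; apply: filter_type_eq.
Qed.

Section Frame.

Variable rep : segment filter_size -> set (form 2).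
Hypothesis rep_mcs : forall t, mcs L (rep t).
Hypothesis rep_onto :
  forall y, mcs L y -> exists t, forall B, B \in G -> rep t B <-> y B.

Let mark i := terminal_mark i (subformulas A).

(** The transitive filtration, except that a point carrying the mark sees
    itself alone: it satisfies a subformula of [A] only if it satisfies its
    necessitation, so that no other successor is called for. *)
Definition filter_acc (i : 'I_2) (t u : segment filter_size) : Prop :=
  t = u \/ ~ rep t (mark i) /\
    forall B, Box i B \in G -> rep t (Box i B) -> rep u (Box i B).

Definition filter_frame : frame 2 :=
  @Frame 2 _ (inhabits (filter_type set0)) filter_acc.

Lemma filter_acc_rep i t y : ~ rep t (mark i) -> mcs L y -> canonical_acc i (rep t) y ->
  exists2 u, filter_acc i t u & forall B, B \in G -> rep u B <-> y B.
Proof.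
move=> tE my ty; have [u uy] := rep_onto my; exists u => //; right; split=> // B BG tB.
by apply/uy => //; apply: ty; apply: (mcs_4 mixL).
Qed.

Lemma mark_terminal i t : rep t (mark i) -> terminal (F := filter_frame) i t.
Proof. by move=> tE u [|[]]. Qed.

(** The mark of one relation is a boxed formula for the other, hence it is
    inherited along the other filtered relation. *)
Lemma mark_persistent i t u :
  rep t (mark i) -> filter_acc (rev_ord i) t u -> rep u (mark i).
Proof. by move=> tE [<-|[_]] //; apply=> //; exact: mem_terminal_mark. Qed.

(** A marked point can serve as its own witness for the mix condition, and an
    unmarked one sees a marked one, just as its representative does. *)
Lemma filter_frame_mix : mix_frame filter_frame.
Proof.
split=> [i t|i t u v|i t]; first by left.
  move=> /= [<-//|[tE tu]] [<-|[uE uv]]; first by right.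
  by right; split=> // B BG tB; apply: uv => //; exact: tu.
suff [u tu uE] : exists2 u, filter_acc i t u & rep u (mark i).
  by exists u => // v uv; apply: mark_terminal; exact: mark_persistent uv.
have [tE|tE] := pselect (rep t (mark i)); first by exists t => //; left.
have [y [my ty yE]] := sees_terminal_mark mixL i (subformulas A) (rep_mcs t).
have [u tu uy] := filter_acc_rep tE my ty.
by exists u => //; apply/uy => //; exact: mem_terminal_mark.
Qed.

Definition filter_valuation (p : nat) : set (world filter_frame) :=
  [set t | rep t (Var p)].

Lemma filter_truth B : B \in subformulas A ->
  forall t : world filter_frame, sat filter_valuation t B <-> rep t B.
Proof.
elim: B => [p||B IHB C IHC|i B IHB] BA t //=.
- by split=> // /(mcs_bot (rep_mcs t)).
- have [/IHB {}IHB /IHC {}IHC] := subformulas_imp BA.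
  rewrite (mcs_imp logicL _ _ (rep_mcs t)).
  by split=> tBC /IHB/tBC/IHC.
- have BA' := subformulas_box BA; have {}IHB := IHB BA'.
have BG := sub_filter_formulas BA.
split=> [tB|tB u [<-|[_ tu]]]; last 2 first.
- by apply/IHB; exact: (mcs_T mixL (rep_mcs t) tB).
- by apply/IHB; apply: (mcs_T mixL (i := i) (rep_mcs u)); exact: tu.
have [tE|tE] := pselect (rep t (mark i)).
  apply: (all_decided_box mixL (rep_mcs t) _ BA'); last by apply/IHB/tB; left.
  exact: (mcs_T mixL (rep_mcs t) tE).
apply/(mcs_box logicL _ _ (rep_mcs t)) => y my ty.
have [u tu uy] := filter_acc_rep tE my ty.
by apply/uy; [exact: sub_filter_formulas|apply/IHB/tB].
Qed.

End Frame.

Lemma finite_countermodel : ~ L A -> exists (n : nat) (o : inhabited (segment n)) acc,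
  [/\ n <= 2 ^ (goedel A + 3), mix_frame (@Frame 2 (segment n) o acc) &
      ~ valid (@Frame 2 (segment n) o acc) A].
Proof.
move=> LA; have [rep [rep_mcs rep_onto]] := filter_representatives LA.
exists filter_size, (inhabits (filter_type set0)), (filter_acc rep); split.
- by rewrite /filter_size card_tuple card_bool leq_exp2l // addn3 !ltnS size_subformulas.
- exact: filter_frame_mix.
have [x mx xA] := not_logic_mcs logicL LA.
have [t tx] := rep_onto x mx.
move=> /(_ (filter_valuation (rep := rep)) t)/(filter_truth rep_mcs rep_onto (mem_subformulas A)).
by move=> /tx tA; apply/xA/tA/sub_filter_formulas/mem_subformulas.
Qed.

End Filtration.

(** * Soundness *)

Lemma valid_logic N (F : frame N) : modal_logic [set A | valid F A].
Proof.
split.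
- move=> A tautA V x.
  have evalE B : beval (fun C => `[< sat V x C >]) B = `[< sat V x B >].
    elim: B => //= [|B -> C ->]; first by apply/esym/asboolP.
    by apply/implyP/asboolP => [BC /asboolP/BC/asboolP|BC /asboolP/BC/asboolP].
  by have := tautA (fun C => `[< sat V x C >]); rewrite evalE => /asboolP.
- by move=> i V x /= xBC xB y xy; exact/xBC/xB.
- move=> s A FA V x.
  have satE B y : sat V y (subst s B) <-> sat (fun p => [set z | sat V z (s p)]) y B.
    elim: B y => //= [B IHB C IHC|i B IHB] y; first by rewrite IHB IHC.
    by split=> yB z /yB /IHB.
  exact/satE/FA.
- by move=> A B FA FAB V x; exact/FAB/FA.
- by move=> i A FA V x y _; exact: FA.
Qed.

Lemma ext_sub_valid N (F : frame N) (M X : set (form N)) :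
  M `<=` [set A | valid F A] -> X `<=` [set A | valid F A] ->
  ext M X `<=` [set A | valid F A].
Proof.
move=> MF XF; apply: smallest_sub; first exact: valid_logic.
by move=> A [/MF|/XF].
Qed.

Lemma K_sub_valid N (F : frame N) : K N `<=` [set A | valid F A].
Proof. by apply: smallest_sub; [exact: valid_logic|move=> A]. Qed.

Definition reduct (F : frame 2) (i : 'I_2) : frame 1 :=
  Frame (world_inhabited F) (fun _ => @acc 2 F i).

Lemma valid_rename F i A : valid (reduct F i) A -> valid F (rename_box i A).
Proof.
move=> FA V x.
have satE B (y : world F) :
    sat V y (rename_box i B) <-> sat (F := reduct F i) V y B.
  elim: B y => //= [B IHB C IHC|j B IHB] y; first by rewrite IHB IHC.
  by split=> yB z /yB /IHB.
exact/satE/FA.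
Qed.

(** The witness of the mix condition is terminal, by reflexivity of the other
    relation, and at a terminal point each formula is decided. *)
Lemma S4_1_valid F i : mix_frame F -> S4_1 `<=` [set A | valid (reduct F i) A].
Proof.
move=> mixF; apply: ext_sub_valid; first apply: ext_sub_valid.
- exact: K_sub_valid.
- move=> A [->|->] V x /= xp; first exact/xp/(frame_refl mixF).
  by move=> y xy z yz; exact/xp/(frame_trans mixF)/yz.
move=> _ -> V x /= xp xnp.
have [y xy yterm] := frame_mix mixF i x.
have {}yterm : terminal i y by apply: yterm; exact: (frame_refl mixF).
apply: (xnp y xy) => z /yterm->.
apply: contrapT => yp; apply: (xp y xy) => w /yterm->; exact: yp.
Qed.

Lemma mix_axiom_valid F i : mix_frame F -> valid F (mix_axiom i (rev_ord i)).
Proof.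
move=> mixF V x /=; have [y xy yterm] := frame_mix mixF i x.
move=> /(_ y xy); apply=> z /yterm zterm zp w /zterm->.
by apply: contrapT => nzp; apply: zp => v /zterm->.
Qed.

Definition mixed_S4_1 : set (form 2) :=
  ext (ext (fusion S4_1 S4_1) [set mix_axiom box1 box2]) [set mix_axiom box2 box1].

Lemma rev_box1 : rev_ord box1 = box2. Proof. exact: val_inj. Qed.
Lemma rev_box2 : rev_ord box2 = box1. Proof. exact: val_inj. Qed.

Lemma mixed_S4_1_sound F : mix_frame F -> mixed_S4_1 `<=` [set A | valid F A].
Proof.
move=> mixF; do 2?apply: ext_sub_valid.
- do 2?apply: ext_sub_valid.
  + exact: K_sub_valid.
  + by move=> _ [A SA <-]; apply/valid_rename/S4_1_valid.
  + by move=> _ [A SA <-]; apply/valid_rename/S4_1_valid.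
- by move=> _ ->; rewrite /= -rev_box1; exact: mix_axiom_valid.
- by move=> _ ->; rewrite /= -rev_box2; exact: mix_axiom_valid.
Qed.

Lemma smallest_logic N (G : set (form N)) : modal_logic (smallest (@modal_logic N) G).
Proof.
split.
- by move=> A tautA M [logicM _]; exact: logic_taut.
- by move=> i M [logicM _]; exact: logic_K.
- by move=> s A GA M [logicM GM]; apply: logic_subst => //; exact: GA.
- by move=> A B GA GAB M [logicM GM]; apply: (logic_mp logicM (A := A)); [exact: GA|exact: GAB].
- by move=> i A GA M [logicM GM]; apply: logic_nec => //; exact: GA.
Qed.

Lemma ext_base N (M G : set (form N)) : M `<=` ext M G.
Proof. by apply: sub_smallest => A MA; left. Qed.

Lemma ext_axiom N (M G : set (form N)) : G `<=` ext M G.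
Proof. by apply: sub_smallest => A GA; right. Qed.

Lemma mixed_S4_1_mix_logic : mix_logic mixed_S4_1.
Proof.
have inS4_1 (i : 'I_2) A : S4_1 A -> mixed_S4_1 (rename_box i A).
  move=> SA; do 2!apply: ext_base; rewrite /fusion.
  case: (ord2P i) => ->; last by apply: ext_axiom; exists A.
  by apply: ext_base; apply: ext_axiom; exists A.
split.
- exact: smallest_logic.
- move=> i; apply: (inS4_1 i (Imp (Box ord0 (Var 0)) (Var 0))).
  by apply: ext_base; apply: ext_axiom; left.
- move=> i; apply: (inS4_1 i (Imp (Box ord0 (Var 0)) (Box ord0 (Box ord0 (Var 0))))).
  by apply: ext_base; apply: ext_axiom; right.
- move=> i; apply: (inS4_1 i (Imp (Box ord0 (Dia ord0 (Var 0))) (Dia ord0 (Box ord0 (Var 0))))).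
  exact: ext_axiom.
- move=> i; case: (ord2P i) => ->; rewrite ?rev_box1 ?rev_box2.
    by apply: ext_base; apply: ext_axiom.
  exact: ext_axiom.
Qed.

Lemma mixed_S4_1_fmp : finite_model_property mixed_S4_1.
Proof.
exists [set F | finite_set [set: world F] /\ mix_frame F]; split; first by move=> F [].
apply/seteqP; split=> [A LA F [_ mixF]|A validA]; first exact: mixed_S4_1_sound.
apply: contrapT => /(finite_countermodel mixed_S4_1_mix_logic)[n [o [acc [_ mixF FA]]]].
by apply/FA/validA; split=> //; exact: finite_segment.
Qed.
(** * Recursive functions of an environment *)

(** Computability is formulated for functions of an environment of variables,
    of any length, in de Bruijn style: under a binder the bound variable is the
    head of the environment and the outer variables are its tail.  Closure
    properties then apply by unification to expressions written with [nth] and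
    [behead]. *)
Definition recursive (f : seq nat -> nat) : Prop :=
  forall n, exists r : recfun n, forall x : n.-tuple nat, computes r x (f x).

Definition recursive_pred (P : seq nat -> bool) : Prop := recursive (fun e => P e).

Lemma recursive_ext f g : f =1 g -> recursive f -> recursive g.
Proof. by move=> fg rf n; have [r rP] := rf n; exists r => x; rewrite -fg. Qed.

Lemma recursive_nth i : recursive (fun e => nth 0 e i).
Proof.
move=> n; have [lt_in|le_ni] := ltnP i n.
  by exists (RProj (Ordinal lt_in)) => x /=; rewrite (tnth_nth 0).
by exists (RZero n) => x /=; rewrite nth_default ?size_tuple.
Qed.

Lemma recursive_const c : recursive (fun=> c).
Proof.
elim: c => [|c IHc] n; first by exists (RZero n).
have [r rP] := IHc n; exists (RComp RSucc (fun=> r)) => x.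
by exists [tuple c]; split=> // i; rewrite (ord1 i); exact: rP.
Qed.

(** Environments can be rearranged, provided that the new length depends only on
    the old one: each length is handled by a function of its own arity. *)
Lemma recursive_reindex (ren len : nat -> nat) f : recursive f ->
  recursive (fun e => f [seq nth 0 e (ren i) | i <- iota 0 (len (size e))]).
Proof.
move=> rf n; have [r rP] := rf (len n).
have /choice[p pP] : forall i : 'I_(len n), exists p : recfun n,
  forall x : n.-tuple nat, computes p x (nth 0 x (ren i)) by move=> i; exact: recursive_nth.
exists (RComp r p) => x; exists [tuple nth 0 x (ren i) | i < len n]; split.
  by move=> i; rewrite tnth_mktuple.
suff -> : [seq nth 0 x (ren i) | i <- iota 0 (len (size x))]
  = [tuple nth 0 x (ren i) | i < len n] by exact: rP.
by rewrite size_tuple -val_enum_ord -map_comp.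
Qed.

Lemma recursive_behead f : recursive f -> recursive (fun e => f (behead e)).
Proof.
move=> rf; apply: recursive_ext (recursive_reindex S predn rf) => e; congr f.
apply: (@eq_from_nth _ 0) => [|i]; rewrite size_map size_iota ?size_behead // => lt_i.
by rewrite (nth_map 0) ?size_iota // nth_iota // nth_behead.
Qed.

Lemma recursive_nth_behead (h : seq nat -> seq nat) i :
  recursive (fun e => nth 0 (h e) i.+1) -> recursive (fun e => nth 0 (behead (h e)) i).
Proof. by apply: recursive_ext => e; rewrite nth_behead. Qed.

(** In the step of a recursion the environment is [k :: u :: e], with [u] the
    value so far; the body of a bounded quantifier expects [k :: e]. *)
Lemma recursive_skip f :
  recursive f -> recursive (fun e => f (nth 0 e 0 :: behead (behead e))).
Proof.
move=> rf; pose ren i := if i is 0 then 0 else i.+1.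
apply: recursive_ext (recursive_reindex ren (fun n => n.-2.+1) rf) => e; congr f.
apply: (@eq_from_nth _ 0) => [|i]; rewrite size_map size_iota /= ?size_behead // => lt_i.
case: i lt_i => [|i] //=; rewrite ltnS => lt_i.
by rewrite (nth_map 0) ?size_iota // nth_iota // !nth_behead.
Qed.

Lemma recursive_rec b f (g : nat -> nat -> seq nat -> nat) :
  recursive b -> recursive f ->
  recursive (fun e => g (nth 0 e 0) (nth 0 e 1) (behead (behead e))) ->
  recursive (fun e => nat_rect (fun=> nat) (f e) (fun k u => g k u e) (b e)).
Proof.
move=> rb rf rg n; have [b' b'P] := rb n; have [f' f'P] := rf n; have [g' g'P] := rg n.+2.
pose args (i : 'I_n.+1) := if unlift ord0 i is Some j then RProj j else b'.
exists (RComp (RPrec f' g') args) => x; exists [tuple of b x :: x]; split.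
  move=> i; rewrite /args; case: unliftP => [j|] ->; last exact: b'P.
  by rewrite tnthS.
exists (nat_rect (fun=> nat) (f x) (fun k u => g k u x)).
have -> : [tuple of behead [tuple of b x :: x]] = x by exact: val_inj.
split=> // k _; exact: (g'P [tuple of k :: nat_rect _ _ _ k :: x]).
Qed.

Lemma recursive_succ f : recursive f -> recursive (fun e => (f e).+1).
Proof.
move=> rf n; have [r rP] := rf n; exists (RComp RSucc (fun=> r)) => x.
by exists [tuple f x]; split=> // i; rewrite (ord1 i); exact: rP.
Qed.

Lemma recursive_pred_nat f : recursive f -> recursive (fun e => (f e).-1).
Proof.
move=> rf; pose g (k u : nat) (e : seq nat) := k.
have := recursive_rec (g := g) rf (recursive_const 0) (recursive_nth 0).
by apply: recursive_ext => e; case: (f e).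
Qed.

Lemma recursive_add f1 f2 : recursive f1 -> recursive f2 ->
  recursive (fun e => f1 e + f2 e).
Proof.
move=> rf1 rf2; pose g (k u : nat) (e : seq nat) := u.+1.
have := recursive_rec (g := g) rf1 rf2 (recursive_succ (recursive_nth 1)).
by apply: recursive_ext => e; elim: (f1 e) => //= m ->.
Qed.

Lemma recursive_sub f1 f2 : recursive f1 -> recursive f2 ->
  recursive (fun e => f1 e - f2 e).
Proof.
move=> rf1 rf2; pose g (k u : nat) (e : seq nat) := u.-1.
have := recursive_rec (g := g) rf2 rf1 (recursive_pred_nat (recursive_nth 1)).
by apply: recursive_ext => e; elim: (f2 e) => /= [|m ->]; rewrite ?subn0 ?subnS.
Qed.

Lemma recursive_mul f1 f2 : recursive f1 -> recursive f2 ->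
  recursive (fun e => f1 e * f2 e).
Proof.
move=> rf1 rf2; pose g (k u : nat) (e : seq nat) := f2 e + u.
have := recursive_rec (g := g) rf1 (recursive_const 0) (recursive_add
  (recursive_behead (recursive_behead rf2)) (recursive_nth 1)).
by apply: recursive_ext => e; elim: (f1 e) => //= m ->; rewrite mulSn.
Qed.

Lemma recursive_exp c f : recursive f -> recursive (fun e => c ^ f e).
Proof.
move=> rf; pose g (k u : nat) (e : seq nat) := c * u.
have := recursive_rec (g := g) rf (recursive_const 1)
  (recursive_mul (recursive_const c) (recursive_nth 1)).
by apply: recursive_ext => e; elim: (f e) => //= m ->; rewrite expnS.
Qed.

Lemma recursive_neg P : recursive_pred P -> recursive_pred (fun e => ~~ P e).
Proof.
move=> rP; have := recursive_sub (recursive_const 1) rP.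
by apply: recursive_ext => e; case: (P e).
Qed.

Lemma recursive_and P Q : recursive_pred P -> recursive_pred Q ->
  recursive_pred (fun e => P e && Q e).
Proof.
by move=> rP rQ; apply: recursive_ext (recursive_mul rP rQ) => e; rewrite mulnb.
Qed.

Lemma recursive_imp P Q : recursive_pred P -> recursive_pred Q ->
  recursive_pred (fun e => P e ==> Q e).
Proof.
move=> rP rQ; apply: recursive_ext (recursive_neg (recursive_and rP (recursive_neg rQ))).
by move=> e; case: (P e); case: (Q e).
Qed.

Lemma recursive_eqn f1 f2 : recursive f1 -> recursive f2 ->
  recursive_pred (fun e => f1 e == f2 e).
Proof.
move=> rf1 rf2; apply: recursive_ext (recursive_sub (recursive_const 1)
  (recursive_add (recursive_sub rf1 rf2) (recursive_sub rf2 rf1))) => e.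
by rewrite eqn_leq -!subn_eq0 -addn_eq0; case: (_ + _).
Qed.

Lemma recursive_eqb P Q : recursive_pred P -> recursive_pred Q ->
  recursive_pred (fun e => P e == Q e).
Proof.
by move=> rP rQ; apply: recursive_ext (recursive_eqn rP rQ) => e; case: (P e); case: (Q e).
Qed.

Lemma recursive_odd f : recursive f -> recursive_pred (fun e => odd (f e)).
Proof.
move=> rf; pose g (k u : nat) (e : seq nat) := 1 - u.
have := recursive_rec (g := g) rf (recursive_const 0)
  (recursive_sub (recursive_const 1) (recursive_nth 1)).
by apply: recursive_ext => e; elim: (f e) => //= m ->; case: (odd m).
Qed.

Lemma recursive_half f : recursive f -> recursive (fun e => (f e)./2).
Proof.
move=> rf; pose g (k u : nat) (e : seq nat) := u + odd k.
have := recursive_rec (g := g) rf (recursive_const 0)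
  (recursive_add (recursive_nth 1) (recursive_odd (recursive_nth 0))).
by apply: recursive_ext => e; elim: (f e) => //= m ->; rewrite uphalf_half addnC.
Qed.

Definition all_below (n : nat) (P : pred nat) : bool := all P (iota 0 n).
Definition has_below (n : nat) (P : pred nat) : bool := has P (iota 0 n).

Lemma all_belowP n (P : pred nat) : reflect (forall k, k < n -> P k) (all_below n P).
Proof.
apply: (iffP allP) => [allP k lt_kn|allP k]; first by apply: allP; rewrite mem_iota.
by rewrite mem_iota => /andP[_]; exact: allP.
Qed.

Lemma has_belowP n (P : pred nat) : reflect (exists2 k, k < n & P k) (has_below n P).
Proof.
by apply: (iffP hasP) => -[k]; rewrite ?mem_iota => lt_kn Pk; exists k; rewrite ?mem_iota.
Qed.

Lemma recursive_all b (P : nat -> seq nat -> bool) : recursive b ->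
  recursive_pred (fun e => P (nth 0 e 0) (behead e)) ->
  recursive_pred (fun e => all_below (b e) (fun k => P k e)).
Proof.
move=> rb rP; pose g (k u : nat) (e : seq nat) := u * P k e.
have rPg : recursive (fun e => P (nth 0 e 0) (behead (behead e))).
  exact: (recursive_skip rP).
have := recursive_rec (g := g) rb (recursive_const 1) (recursive_mul (recursive_nth 1) rPg).
apply: recursive_ext => e; rewrite /all_below; elim: (b e) => // m IHm.
by rewrite -[in RHS]addn1 iotaD all_cat /= IHm andbT /g mulnb.
Qed.

Lemma recursive_has b (P : nat -> seq nat -> bool) : recursive b ->
  recursive_pred (fun e => P (nth 0 e 0) (behead e)) ->
  recursive_pred (fun e => has_below (b e) (fun k => P k e)).
Proof.
move=> rb rP; apply: recursive_ext (recursive_neg (recursive_all rb (recursive_neg rP))) => e.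
by rewrite /has_below -[has _ _]negbK -all_predC.
Qed.

Definition bit (m k : nat) : bool := odd (iter k half m).

Lemma recursive_bit f1 f2 : recursive f1 -> recursive f2 ->
  recursive_pred (fun e => bit (f1 e) (f2 e)).
Proof.
move=> rf1 rf2; apply: recursive_odd; pose g (k u : nat) (e : seq nat) := u./2.
have := recursive_rec (g := g) rf2 rf1 (recursive_half (recursive_nth 1)).
by apply: recursive_ext => e; elim: (f2 e) => //= m ->.
Qed.

Lemma recursive_cpair f1 f2 : recursive f1 -> recursive f2 ->
  recursive (fun e => cpair (f1 e) (f2 e)).
Proof.
move=> rf1 rf2; have rs := recursive_add rf1 rf2.
exact: recursive_add (recursive_half (recursive_mul rs (recursive_succ rs))) rf2.
Qed.
(** * The search for countermodels *)

Lemma exists_mask (P : pred nat) k :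
  exists2 m, m < 2 ^ k & forall j, bit m j = (j < k) && P j.
Proof.
elim: k P => [|k IHk] P.
  by exists 0 => // j; rewrite /bit; elim: j => // j IHj; rewrite iterSr.
have [m lt_m mP] := IHk (fun j => P j.+1).
exists (P 0 + m.*2) => [|[|j]]; last 2 first.
- by rewrite /bit /= oddD odd_double addbF oddb.
- by rewrite ltnS -mP /bit iterSr half_bit_double.
rewrite expnS mul2n -(leq_double m.+1) in lt_m *; apply: leq_trans lt_m.
by rewrite doubleS; case: (P 0).
Qed.

Lemma exists_table (P : nat -> nat -> bool) k l :
  exists2 m, m < 2 ^ cpair k l &
    forall x y, x < k -> y < l -> bit m (cpair x y) = P x y.
Proof.
have [m lt_m mP] := exists_mask
  (fun j => [exists x : 'I_k, exists y : 'I_l, (cpair x y == j) && P x y]) (cpair k l).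
exists m => // x y lt_x lt_y; rewrite mP cpair_lt //=.
apply/existsP/idP => [[x' /existsP[y' /andP[/eqP/cpair_inj[-> ->]]]] //|Pxy].
by exists (Ordinal lt_x); apply/existsP; exists (Ordinal lt_y); rewrite eqxx.
Qed.

(** The numbers [r] and [s] are tables of the two relations on the worlds
    [0, ..., n - 1]. *)
Definition frame_code (n r s : nat) : bool :=
  all_below n (fun x =>
    [&& bit r (cpair x x),
        all_below n (fun y => all_below n (fun z =>
          bit r (cpair x y) ==> bit r (cpair y z) ==> bit r (cpair x z))) &
        has_below n (fun y => bit r (cpair x y) && all_below n (fun z =>
          bit s (cpair y z) ==> all_below n (fun w => bit r (cpair z w) ==> (w == z))))]).

Definition box_code (n r g v i c x : nat) : bool :=
  bit g (cpair 3 (cpair i c)) ==>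
  bit g c && (bit v (cpair (cpair 3 (cpair i c)) x) ==
              all_below n (fun y => bit r (cpair x y) ==> bit v (cpair c y))).

Definition imp_code (g v b c x : nat) : bool :=
  bit g (cpair 2 (cpair b c)) ==>
  [&& bit g b, bit g c &
      bit v (cpair (cpair 2 (cpair b c)) x) ==
      (bit v (cpair b x) ==> bit v (cpair c x))].

(** The set [g] of codes, closed under subformulas, confines the conditions on
    the truth table [v] to numbers that do code formulas. *)
Definition truth_code (a n r s g v : nat) : bool :=
  all_below n (fun x =>
    (bit g (cpair 1 0) ==> ~~ bit v (cpair (cpair 1 0) x)) &&
    all_below a.+1 (fun c =>
      [&& box_code n r g v 0 c x, box_code n s g v 1 c x &
          all_below a.+1 (fun b => imp_code g v b c x)])).

(** The bound on the number of worlds is that of [finite_countermodel]; the other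
    bounds leave room for a binary digit at each position that is looked up. *)
Definition refuted (a : nat) : bool :=
  has_below (2 ^ (a + 3)).+1 (fun n =>
  has_below (2 ^ cpair n n) (fun r =>
  has_below (2 ^ cpair n n) (fun s =>
  has_below (2 ^ a.+1) (fun g =>
  has_below (2 ^ cpair a.+1 n) (fun v =>
    [&& frame_code n r s, frame_code n s r, truth_code a n r s g v, bit g a &
        has_below n (fun x => ~~ bit v (cpair a x))]))))).

Lemma recursive_refuted : recursive_pred (fun e => refuted (nth 0 e 0)).
Proof.
rewrite /refuted /truth_code /frame_code /box_code /imp_code.
repeat first
  [ apply: recursive_has | apply: recursive_all | apply: recursive_and
  | apply: recursive_imp | apply: recursive_neg | apply: recursive_eqb
  | apply: recursive_eqn | apply: recursive_bit | apply: recursive_cpair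
  | apply: recursive_exp | apply: recursive_succ | apply: recursive_add
  | apply: recursive_const | apply: recursive_nth_behead | apply: recursive_nth ].
Qed.

Definition mask_of (r s : nat) (i : 'I_2) : nat := if val i == 0 then r else s.

Definition frame_of_code n (o : inhabited (segment n)) r s : frame 2 :=
  Frame o (fun i x y => is_true (bit (mask_of r s i) (cpair (sval x) (sval y)))).

Lemma frame_codeP n (o : inhabited (segment n)) r s :
  frame_code n r s -> frame_code n s r -> mix_frame (frame_of_code o r s).
Proof.
move=> rs sr; have codeP i : frame_code n (mask_of r s i) (mask_of r s (rev_ord i)).
  by case: (ord2P i) => ->; rewrite ?rev_box1 ?rev_box2.
split=> [i [x lt_x]|i [x lt_x] [y lt_y] [z lt_z]|i [x lt_x]] /=.
- by case/all_belowP/(_ x lt_x)/and3P: (codeP i).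
- case/all_belowP/(_ x lt_x)/and3P: (codeP i) => _ /all_belowP/(_ y lt_y)/all_belowP/(_ z lt_z).
  by move=> /implyP xyz _ /xyz/implyP.
case/all_belowP/(_ x lt_x)/and3P: (codeP i) => _ _ /has_belowP[y lt_y /andP[xy yP]].
exists (exist _ y lt_y) => // -[z lt_z] /= yz [w lt_w] /= zw.
apply: segment_eq; apply/eqP => /=.
by move/all_belowP/(_ z lt_z)/implyP/(_ yz)/all_belowP/(_ w lt_w)/implyP/(_ zw): yP.
Qed.

Definition valuation_of_code n v (p : nat) : set (segment n) :=
  [set x | bit v (cpair (cpair 0 p) (sval x))].

Lemma truth_codeP a n (o : inhabited (segment n)) r s g v B :
  truth_code a n r s g v -> goedel B <= a -> bit g (goedel B) ->
  forall x : world (frame_of_code o r s),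
  @sat 2 (frame_of_code o r s) (@valuation_of_code n v) x B <->
  bit v (cpair (goedel B) (sval x)).
Proof.
move=> /all_belowP tv; elim: B => [p||B IHB C IHC|i B IHB] le_a gB [x lt_x] //=.
- by have /andP[/implyP/(_ gB)/negPf->] := tv x lt_x.
- have /andP[le_B le_C] : (goedel B <= a) && (goedel C <= a).
    rewrite !(leq_trans (goedel_subformulas _) le_a) //;
    by rewrite /= inE mem_cat !mem_subformulas !orbT.
  have /andP[_ /all_belowP/(_ (goedel C) le_C)/and3P[_ _]] := tv x lt_x.
  move=> /all_belowP/(_ (goedel B) le_B)/implyP/(_ gB)/and3P[gB' gC /eqP->].
  by rewrite IHB // IHC //; split=> [BC|/implyP//]; apply/implyP.
have le_B : goedel B <= a.
  by apply: leq_trans (goedel_subformulas _) le_a; rewrite /= inE mem_subformulas orbT.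
have : box_code n (mask_of r s i) g v i (goedel B) x.
  have /andP[_ /all_belowP/(_ (goedel B) le_B)/and3P[]] := tv x lt_x.
  by case: (ord2P i) => ->.
move=> /implyP/(_ gB)/andP[gB' /eqP->].
split=> [xB|/all_belowP xB [y lt_y] /= xy]; last by apply/IHB => //; exact: (implyP (xB y lt_y)).
apply/all_belowP => y lt_y; apply/implyP => xy.
by apply/(IHB le_B gB' (exist _ y lt_y))/xB.
Qed.

(** A code found by the search is read back as a frame and a valuation, on which
    [A] fails by [truth_codeP]. *)
Lemma refuted_sound A : refuted (goedel A) -> ~ mixed_S4_1 A.
Proof.
case/has_belowP=> n _ /has_belowP[r _ /has_belowP[s _ /has_belowP[g _ /has_belowP[v _]]]].
case/and5P=> rs sr tv gA /has_belowP[x lt_x xA] LA.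
pose w : segment n := exist _ x lt_x; pose o := inhabits w.
have mixF := frame_codeP o rs sr.
have := mixed_S4_1_sound mixF LA (@valuation_of_code n v) w.
by move=> /(truth_codeP (o := o) tv (leqnn _) gA); apply/negP.
Qed.

Lemma goedel_bot N (B : form N) : goedel B = cpair 1 0 -> B = Bot.
Proof. by case: B => [p||B C|i B] //= /cpair_inj[]. Qed.

Lemma goedel_imp N (B : form N) b c : goedel B = cpair 2 (cpair b c) ->
  exists B1 B2, [/\ B = Imp B1 B2, goedel B1 = b & goedel B2 = c].
Proof. by case: B => [p||B C|i B] //= /cpair_inj[] // _ /cpair_inj[<- <-]; exists B, C. Qed.

Lemma goedel_box N (B : form N) (i : 'I_N) c : goedel B = cpair 3 (cpair i c) ->
  exists2 C, B = Box i C & goedel C = c.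
Proof. by case: B => [p||B C|j B] //= /cpair_inj[] // _ /cpair_inj[/val_inj -> <-]; exists B. Qed.

(** The tables are those of the countermodel given by the filtration, and [g] is
    the set of codes of subformulas of [A]; as Goedel numbering is injective,
    the entry of a code in the truth table is well defined. *)
Lemma refuted_complete A : ~ mixed_S4_1 A -> refuted (goedel A).
Proof.
move=> /(finite_countermodel mixed_S4_1_mix_logic)[n [o [acc [le_n mixF FA]]]].
set F := Frame o acc in mixF FA.
have [V [x0 x0A]] : exists V (x : world F), ~ sat V x A.
  by apply: contrapT => noV; apply: FA => V x; apply: contrapT => xA; apply: noV; exists V, x.
(* numbers outside the segment are sent to an arbitrary world *)
pose at_ x : segment n := insubd (x0 : segment n) x.
have at_val x : x < n -> sval (at_ x) = x by move=> lt_x; exact: insubdK.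
have at_sval w : at_ (sval w) = w by exact: valKd.
have at_lt (w : segment n) : sval w < n by exact: (svalP w).
have tableP i := exists_table (fun x y => `[< acc i (at_ x) (at_ y) >]) n n.
have [r lt_r rP] := tableP box1; have [s lt_s sP] := tableP box2.
have [g lt_g gP] := exists_mask
  (fun c => has (fun B => goedel B == c) (subformulas A)) (goedel A).+1.
have [v lt_v vP] := exists_table (fun c x =>
  `[< exists2 B, B \in subformulas A & goedel B = c /\ sat V (at_ x) B >]) (goedel A).+1 n.
have gB B : B \in subformulas A -> bit g (goedel B).
  by move=> BA; rewrite gP ltnS goedel_subformulas //=; apply/hasP; exists B.
have gE c : bit g c -> exists2 B, B \in subformulas A & goedel B = c.
  by rewrite gP => /andP[_ /hasP[B BA /eqP]]; exists B.
have vB B x : B \in subformulas A -> x < n ->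
    bit v (cpair (goedel B) x) = `[< sat V (at_ x) B >].
  move=> BA lt_x; rewrite vP ?ltnS ?goedel_subformulas //.
  by apply: asbool_equiv_eq; split=> [[C _ [/goedel_inj->]]|xB] //; exists B.
have maskP i x y : x < n -> y < n ->
    bit (mask_of r s i) (cpair x y) = `[< acc i (at_ x) (at_ y) >].
  by move=> lt_x lt_y; case: (ord2P i) => ->; [exact: rP|exact: sP].
have codeF i : frame_code n (mask_of r s i) (mask_of r s (rev_ord i)).
  apply/all_belowP => x lt_x; apply/and3P; split.
  - by rewrite maskP //; apply/asboolP; exact: (frame_refl mixF).
  - apply/all_belowP => y lt_y; apply/all_belowP => z lt_z; rewrite !maskP //.
    apply/implyP => /asboolP xy; apply/implyP => /asboolP yz; apply/asboolP.
    exact: (frame_trans mixF xy yz).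
  have [y xy yterm] := frame_mix mixF i (at_ x).
  apply/has_belowP; exists (sval y) => //; rewrite maskP // at_sval.
  apply/andP; split; first exact/asboolP.
  apply/all_belowP => z lt_z; rewrite maskP // at_sval; apply/implyP => /asboolP/yterm zterm.
  apply/all_belowP => w lt_w; rewrite maskP //; apply/implyP => /asboolP/zterm eq_wz.
  by rewrite -(at_val w lt_w) eq_wz at_val.
have codeB (i : 'I_2) c x : x < n -> box_code n (mask_of r s i) g v i c x.
  move=> lt_x; apply/implyP => /gE[B BA] /goedel_box[C eqB eqC]; subst B c.
  have CA := subformulas_box BA; rewrite gB //= (vB _ x BA lt_x); apply/eqP.
  apply/asboolP/all_belowP => [xC y lt_y|xC y xy].
    by rewrite maskP // vB //; apply/implyP => /asboolP/xC yC; exact/asboolP.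
  have := xC (sval y) (at_lt y); rewrite maskP // vB // at_sval.
  by move=> /implyP/(_ (asboolT xy))/asboolP.
apply/has_belowP; exists n; first by rewrite ltnS.
apply/has_belowP; exists r => //; apply/has_belowP; exists s => //.
apply/has_belowP; exists g => //; apply/has_belowP; exists v => //.
apply/and5P; split; [exact: (codeF box1)|exact: (codeF box2)| | |].
- apply/all_belowP => x lt_x; apply/andP; split.
    apply/implyP => /gE[B BA] /[dup] eqB /goedel_bot eqBot; subst B.
    by rewrite -eqB vB //; apply/asboolP.
  apply/all_belowP => c _; rewrite (codeB box1) // (codeB box2) //=.
  apply/all_belowP => b _; apply/implyP => /gE[B BA] /goedel_imp[B1 [B2 [eqB eqB1 eqB2]]].
  subst B b c; have [B1A B2A] := subformulas_imp BA.
  rewrite !gB //= (vB _ x BA lt_x) !vB //; apply/eqP.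
  apply/asboolP/implyP => [BC /asboolP/BC/asboolP|BC /asboolP/BC/asboolP] //.
- exact/gB/mem_subformulas.
apply/has_belowP; exists (sval x0) => //; rewrite vB ?mem_subformulas // at_sval.
exact/asboolP.
Qed.

Lemma mixed_S4_1_decidable : decidable_logic mixed_S4_1.
Proof.
have [f fP] := recursive_neg recursive_refuted 1; exists f => A.
have /= := fP [tuple goedel A].
case refA : (refuted (goedel A)) => fA; split=> // LA.
  by case: (refuted_sound refA LA).
by move: refA; rewrite refuted_complete.
Qed.

Theorem theorem5p10 :
  let L := ext (ext (fusion S4_1 S4_1) [set mix_axiom box1 box2])
               [set mix_axiom box2 box1] in
  finite_model_property L /\ decidable_logic L.
Proof. by split; [exact: mixed_S4_1_fmp|exact: mixed_S4_1_decidable]. Qed.
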